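(* Let $a$ be a rational number with $a\in\mathbb{Z}_p$ (i.e. $|a|_p\le1$) for every prime $p$, and let $F(x)=\sum_{n=1}^{\infty}\binom an x^n$. If $x=(x_\infty,x_2,\dots,x_p,\dots)$ is an adele with $|x_v|_v<1$ for all $v\in\{\infty,2,3,\dots,p,\dots\}$, then the sequence $$\mathcal{F}(x)=\big(F(x_\infty),F(x_2),\dots,F(x_p),\dots\big)$$ is an adele.
   Context: $\binom an=\frac{a(a-1)\cdots(a-n+1)}{n!}$. $|\cdot|_\infty$ is the usual absolute value on $\mathbb{R}$; for a prime $p$, $|\cdot|_p$ is the $p$-adic absolute value on $\mathbb{Q}_p$, and $\mathbb{Z}_p$ is the ring of $p$-adic integers. An adele is an infinite sequence $a=(a_\infty,a_2,\dots,a_p,\dots)$, indexed by $\infty$ and the primes, in which $a_\infty\in\mathbb{R}$, $a_p\in\mathbb{Q}_p$ for each prime $p$, and $a_p\in\mathbb{Z}_p$ for all but finitely many $p$. $F(x_\infty)$ is the sum of the series in $\mathbb{R}$ and $F(x_p)$ is the sum of the series in $\mathbb{Q}_p$. *)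

(* Defs.v *)
From HB Require Import structures.
From mathcomp Require Import all_boot all_order all_algebra.
From mathcomp Require Import all_classical all_reals all_analysis.
From mathcomp Require Import zify ring lra.

Set Implicit Arguments.
Unset Strict Implicit.
Unset Printing Implicit Defensive.

Import Order.TTheory GRing.Theory Num.Theory.
Import numFieldNormedType.Exports.

Local Open Scope classical_set_scope.
Local Open Scope ring_scope.
Local Open Scope quotient_scope.

Record prime_nat := PrimeNat { prime_val :> nat; prime_valP : prime prime_val }.

HB.instance Definition _ := [isSub for prime_val].
HB.instance Definition _ := [Countable of prime_nat by <:].

(* The rational |q|_p = p ^ - (v_p (numerator) - v_p (denominator)). *)
Definition rat_padic_abs (p : nat) (q : rat) : rat :=
  if q == 0 then 0
  else p%:R ^ ((logn p `|denq q|)%:Z - (logn p `|numq q|)%:Z).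

Section RatPadicAbs.
Variable p : prime_nat.
Implicit Types q r : rat.
Local Notation absp := (rat_padic_abs p).

Let p_pr : prime p := prime_valP p.
Let p_neq0 : (p : nat)%:R != 0 :> rat.
Proof. by rewrite pnatr_eq0 -lt0n prime_gt0. Qed.
Let p_gt0 : 0 < (p : nat)%:R :> rat.
Proof. by rewrite ltr0n prime_gt0. Qed.
Let p_gt1 : 1 < (p : nat)%:R :> rat.
Proof. by rewrite ltr1n prime_gt1. Qed.

Lemma rat_padic_abs0 : absp 0 = 0.
Proof. by rewrite /rat_padic_abs eqxx. Qed.

Lemma rat_padic_abs_gt0 q : (0 < absp q) = (q != 0).
Proof.
rewrite /rat_padic_abs; case: eqP => _; first by rewrite ltxx.
by rewrite exprz_gt0.
Qed.

Lemma rat_padic_abs_ge0 q : 0 <= absp q.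
Proof.
have [->|q0] := eqVneq q 0; first by rewrite rat_padic_abs0.
by rewrite ltW// rat_padic_abs_gt0.
Qed.

Lemma rat_padic_abs_eq0 q : (absp q == 0) = (q == 0).
Proof. by rewrite -[RHS]negbK -rat_padic_abs_gt0 lt0r rat_padic_abs_ge0 andbT negbK. Qed.

Lemma rat_padic_abs_frac (m n : int) : m != 0 -> n != 0 ->
  absp (m%:~R / n%:~R) = (p : nat)%:R ^ ((logn p `|n|)%:Z - (logn p `|m|)%:Z).
Proof.
move=> m0 n0; set q := m%:~R / n%:~R.
have nQ0 : n%:~R != 0 :> rat by rewrite intr_eq0.
have q0 : q != 0 by rewrite mulf_neq0 ?invr_eq0 ?intr_eq0.
rewrite /rat_padic_abs (negbTE q0); congr (_ ^ _).
have E : (numq q * n = m * denq q)%R.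
  apply: (@intr_inj rat); rewrite !intrM.
  have dq0 : (denq q)%:~R != 0 :> rat by rewrite intr_eq0 denq_neq0.
  apply: (mulIf (invr_neq0 nQ0)); apply: (mulIf (invr_neq0 dq0)).
  by rewrite mulfK// divq_num_den mulrAC mulfK.
have /(congr1 (logn p)) : (`|numq q| * `|n| = `|m| * `|denq q|)%N by rewrite -!abszM E.
rewrite !lognM ?absz_gt0 ?numq_eq0 ?denq_neq0// => H.
by lia.
Qed.

Lemma rat_padic_abs1 : absp 1 = 1.
Proof. by have := @rat_padic_abs_frac 1 1 isT isT; rewrite divr1 subrr expr0z. Qed.

Lemma rat_padic_absM q r : absp (q * r) = absp q * absp r.
Proof.
have [->|q0] := eqVneq q 0; first by rewrite !(mul0r, rat_padic_abs0).
have [->|r0] := eqVneq r 0; first by rewrite !(mulr0, rat_padic_abs0).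
rewrite -{1}(divq_num_den q) -{1}(divq_num_den r) mulf_div -!intrM.
rewrite rat_padic_abs_frac ?mulf_neq0 ?numq_eq0 ?denq_neq0//.
rewrite /rat_padic_abs (negbTE q0) (negbTE r0) -expfzDr//; congr (_ ^ _).
rewrite !abszM !lognM ?absz_gt0 ?numq_eq0 ?denq_neq0//.
by rewrite !PoszD opprD addrACA.
Qed.

Lemma rat_padic_absN q : absp (- q) = absp q.
Proof.
by rewrite /rat_padic_abs oppr_eq0 numqN denqN abszN.
Qed.

Lemma rat_padic_absB q r : absp (q - r) = absp (r - q).
Proof. by rewrite -rat_padic_absN opprB. Qed.

Lemma rat_padic_absV q : absp q^-1 = (absp q)^-1.
Proof.
have [->|q0] := eqVneq q 0; first by rewrite !(invr0, rat_padic_abs0).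
have a0 : absp q != 0 by rewrite rat_padic_abs_eq0.
by apply: (mulfI a0); rewrite -rat_padic_absM !mulfV// rat_padic_abs1.
Qed.

Let rat_padic_abs_intD (m n : int) :
  absp (m + n)%:~R <= Num.max (absp m%:~R) (absp n%:~R).
Proof.
have [->|m0] := eqVneq m 0; first by rewrite add0r le_max lexx orbT.
have [->|n0] := eqVneq n 0; first by rewrite addr0 le_max lexx.
have [->|mn0] := eqVneq (m + n) 0.
  by rewrite rat_padic_abs0 le_max rat_padic_abs_ge0.
have absE k : k != 0 -> absp k%:~R = (p : nat)%:R ^ (- (logn p `|k|)%:Z).
  move=> k0; have := @rat_padic_abs_frac k 1 k0 isT.
  by rewrite divr1 logn1 sub0r.
rewrite !absE// le_max !ler_eXz2l// !lerN2 !lez_nat -geq_min.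
have mnN0 : (0 < absz (m + n)%R)%N by rewrite absz_gt0.
rewrite -(pfactor_dvdn _ p_pr mnN0) -[X in is_true X]/(dvdz (p ^ _)%N (m + n)).
by apply: rpredD; rewrite /= unfold_in/= pfactor_dvdn ?absz_gt0 // (geq_minl, geq_minr).
Qed.

Lemma rat_padic_absD q r : absp (q + r) <= Num.max (absp q) (absp r).
Proof.
rewrite -(divq_num_den q) -(divq_num_den r).
set a := numq q; set b := denq q; set c := numq r; set d := denq r.
have b0 : b%:~R != 0 :> rat by rewrite intr_eq0 denq_neq0.
have d0 : d%:~R != 0 :> rat by rewrite intr_eq0 denq_neq0.
have bd0 : 0 < absp (b%:~R * d%:~R) by rewrite rat_padic_abs_gt0 mulf_neq0.
rewrite addf_div// -!intrM -intrD intrM -(ler_pM2r bd0) -rat_padic_absM.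
rewrite mulfVK ?mulf_neq0// (le_trans (rat_padic_abs_intD _ _))//.
rewrite maxr_pMl ?(ltW bd0)// -!rat_padic_absM !intrM mulrA mulfVK//.
by rewrite (mulrC b%:~R) mulrA mulfVK.
Qed.

Lemma rat_padic_abs_eqD q r : absp q < absp r -> absp (q + r) = absp r.
Proof.
move=> qr; apply/eqP; rewrite eq_le; apply/andP; split.
  by rewrite (le_trans (rat_padic_absD _ _))// ge_max lexx ltW.
have := rat_padic_absD (- q) (q + r).
by rewrite addKr rat_padic_absN le_max leNgt qr.
Qed.

End RatPadicAbs.

Definition padic_cauchy (p : prime_nat) : {pred nat -> rat} := fun u =>
  `[< forall e : rat, 0 < e -> exists N, forall m n, (N <= m)%N -> (N <= n)%N ->
      rat_padic_abs p (u m - u n) < e >].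

Lemma padic_cauchyP (p : prime_nat) (u : nat -> rat) : reflect
  (forall e : rat, 0 < e -> exists N, forall m n, (N <= m)%N -> (N <= n)%N ->
     rat_padic_abs p (u m - u n) < e) (u \in padic_cauchy p).
Proof. exact: asboolP. Qed.

Lemma padic_cauchy_bounded (p : prime_nat) (u : nat -> rat) : u \in padic_cauchy p ->
  exists2 M, 0 < M & exists N, forall n, (N <= n)%N -> rat_padic_abs p (u n) <= M.
Proof.
move=> /padic_cauchyP /(_ 1 ltr01)[N uN].
exists (Num.max 1 (rat_padic_abs p (u N))); first by rewrite lt_max ltr01.
exists N => n Nn; rewrite -[u n](subrK (u N)).
rewrite (le_trans (rat_padic_absD _ _ _))// ge_max !le_max lexx orbT andbT.
by rewrite ltW// uN.
Qed.

Lemma padic_cauchy_subring (p : prime_nat) : subring_closed (padic_cauchy p).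
Proof.
split.
- apply/padic_cauchyP => e e0; exists 0%N => m n _ _.
  by rewrite subrr rat_padic_abs0.
- move=> u v /padic_cauchyP uC /padic_cauchyP vC; apply/padic_cauchyP => e e0.
  have [N1 H1] := uC e e0; have [N2 H2] := vC e e0.
  exists (maxn N1 N2) => m n; rewrite !geq_max => /andP[m1 m2] /andP[n1 n2].
  have -> : (u - v) m - (u - v) n = (u m - u n) + (v n - v m).
    by rewrite !fctE; ring.
  by rewrite (le_lt_trans (rat_padic_absD _ _ _))// gt_max H1// H2.
- move=> u v uc vc.
  have [M1 M10 [K1 HM1]] := padic_cauchy_bounded uc.
  have [M2 M20 [K2 HM2]] := padic_cauchy_bounded vc.
  apply/padic_cauchyP => e e0.
  have /padic_cauchyP/(_ (e / M2) (divr_gt0 e0 M20))[N1 H1] := uc.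
  have /padic_cauchyP/(_ (e / M1) (divr_gt0 e0 M10))[N2 H2] := vc.
  exists (maxn (maxn N1 N2) (maxn K1 K2)) => m n.
  rewrite !geq_max => /andP[/andP[m1 m2] /andP[m3 m4]].
  move=> /andP[/andP[n1 n2] /andP[n3 n4]].
  have -> : (u * v) m - (u * v) n = (u m - u n) * v m + u n * (v m - v n).
    by rewrite !fctE; ring.
  rewrite (le_lt_trans (rat_padic_absD _ _ _))// gt_max !rat_padic_absM.
  apply/andP; split.
    rewrite (@le_lt_trans _ _ (rat_padic_abs p (u m - u n) * M2))//.
      by rewrite ler_wpM2l ?rat_padic_abs_ge0// HM2.
    by rewrite -ltr_pdivlMr// H1.
  rewrite (@le_lt_trans _ _ (M1 * rat_padic_abs p (v m - v n)))//.
    by rewrite ler_wpM2r ?rat_padic_abs_ge0// HM1.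
  by rewrite mulrC -ltr_pdivlMr// H2.
Qed.

HB.instance Definition _ p :=
  GRing.isSubringClosed.Build (nat -> rat) (padic_cauchy p) (padic_cauchy_subring p).

Record padic_cauchy_seq (p : prime_nat) := PadicCauchySeq {
  padic_seq :> nat -> rat; padic_seqP : padic_seq \in padic_cauchy p }.

HB.instance Definition _ p := [isSub for @padic_seq p].
HB.instance Definition _ p := [Choice of padic_cauchy_seq p by <:].
HB.instance Definition _ p :=
  [SubChoice_isSubComNzRing of padic_cauchy_seq p by <:].

Definition padic_null (p : prime_nat) : {pred padic_cauchy_seq p} := fun u =>
  `[< forall e : rat, 0 < e -> exists N, forall n, (N <= n)%N ->
      rat_padic_abs p (u n) < e >].

Arguments padic_null : clear implicits.

Lemma padic_nullP (p : prime_nat) (u : padic_cauchy_seq p) : reflect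
  (forall e : rat, 0 < e -> exists N, forall n, (N <= n)%N ->
     rat_padic_abs p (u n) < e) (u \in padic_null p).
Proof. exact: asboolP. Qed.

Lemma padic_seqD (p : prime_nat) (u v : padic_cauchy_seq p) n : (u + v) n = u n + v n.
Proof. by []. Qed.

Lemma padic_seqN (p : prime_nat) (u : padic_cauchy_seq p) n : (- u) n = - u n.
Proof. by []. Qed.

Lemma padic_seqM (p : prime_nat) (u v : padic_cauchy_seq p) n : (u * v) n = u n * v n.
Proof. by []. Qed.

Lemma padic_null_ideal (p : prime_nat) : idealr_closed (padic_null p).
Proof.
split.
- by apply/padic_nullP => e e0; exists 0%N => n _; rewrite rat_padic_abs0.
- apply/negP => /padic_nullP/(_ 1 ltr01)[N /(_ N (leqnn N))].
  by rewrite rat_padic_abs1 ltxx.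
- move=> a u v /padic_nullP uN /padic_nullP vN; apply/padic_nullP => e e0.
  have [M M0 [K HM]] := padic_cauchy_bounded (padic_seqP a).
  have [N1 H1] := uN (e / M) (divr_gt0 e0 M0).
  have [N2 H2] := vN e e0.
  exists (maxn K (maxn N1 N2)) => n; rewrite !geq_max => /and3P[nK n1 n2].
  rewrite padic_seqD padic_seqM (le_lt_trans (rat_padic_absD _ _ _))//.
  rewrite gt_max H2// andbT rat_padic_absM.
  rewrite (@le_lt_trans _ _ (M * rat_padic_abs p (u n)))//.
    by rewrite ler_wpM2r ?rat_padic_abs_ge0// HM.
  by rewrite mulrC -ltr_pdivlMr// H1.
Qed.

HB.instance Definition _ p :=
  isIdealr.Build (padic_cauchy_seq p) (padic_null p) (padic_null_ideal p).

(* The completion of rat for |.|_p: Cauchy sequences modulo null sequences. *)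
Definition Qp (p : prime_nat) : Type := {ideal_quot (padic_null p)}.

HB.instance Definition _ p := GRing.ComNzRing.on (Qp p).

Section PadicField.
Variable p : prime_nat.
Local Notation absp := (rat_padic_abs p).
Implicit Types (u v : padic_cauchy_seq p) (x y : Qp p).

Definition Qp_class u : Qp p := \pi_{ideal_quot (padic_null p)} u.

Lemma Qp_class_is_zmod_morphism : zmod_morphism Qp_class.
Proof. by move=> u v; rewrite /Qp_class !piE. Qed.
Lemma Qp_class_is_monoid_morphism : monoid_morphism Qp_class.
Proof. by split=> [|u v]; rewrite /Qp_class !piE. Qed.
HB.instance Definition _ := GRing.isZmodMorphism.Build _ (Qp p)
  Qp_class Qp_class_is_zmod_morphism.
HB.instance Definition _ := GRing.isMonoidMorphism.Build _ (Qp p)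
  Qp_class Qp_class_is_monoid_morphism.

Definition Qp_repr x : padic_cauchy_seq p := repr (x : {ideal_quot (padic_null p)}).

Lemma Qp_reprK : cancel Qp_repr Qp_class.
Proof. by move=> x; rewrite /Qp_class /Qp_repr reprK. Qed.

Lemma Qp_class_eq u v : (Qp_class u == Qp_class v) = (u - v \in padic_null p).
Proof. by rewrite Quotient.idealrBE. Qed.

Lemma Qp_class_eq0 u : (Qp_class u == 0) = (u \in padic_null p).
Proof. by rewrite -(rmorph0 Qp_class) Qp_class_eq subr0. Qed.

(* Off the null sequences, the absolute value is eventually constant. *)
Lemma padic_abs_stationary u : u \notin padic_null p ->
  exists2 c, 0 < c & exists N, forall n, (N <= n)%N -> absp (u n) = c.
Proof.
move=> /asboolPn /existsNP[e /not_implyP[e0 /forallNP eN]].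
have /padic_cauchyP /(_ e e0)[N uN] := padic_seqP u.
have [n0 /not_implyP[Nn0 /negP]] := (existsNP _).2 (eN N).
rewrite -leNgt => en0; exists (absp (u n0)); first exact: lt_le_trans en0.
exists N => n Nn; rewrite -(subrK (u n0) (u n)) rat_padic_abs_eqD//.
by apply: lt_le_trans en0; apply: uN.
Qed.

Lemma Qp_has_inverse x : x != 0 -> exists y, y * x = 1.
Proof.
rewrite -(Qp_reprK x); move: (Qp_repr x) => u; rewrite Qp_class_eq0 => unull.
have [c c0 [N uc]] := padic_abs_stationary unull.
have un0 n : (N <= n)%N -> u n != 0.
  by move=> /uc un; rewrite -(rat_padic_abs_gt0 p) un.
have vC : (fun n => (u n)^-1) \in padic_cauchy p.
  apply/padic_cauchyP => e e0.
  have /padic_cauchyP /(_ (e * c ^+ 2))[|K uK] := padic_seqP u.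
    by rewrite mulr_gt0// exprn_gt0.
  exists (maxn N K) => m n; rewrite !geq_max => /andP[Nm Km] /andP[Nn Kn].
  have -> : (u m)^-1 - (u n)^-1 = (u n - u m) / (u m * u n).
    by field; rewrite !un0.
  rewrite rat_padic_absM rat_padic_absV rat_padic_absM !uc//.
  by rewrite ltr_pdivrMr ?mulr_gt0// -expr2 uK.
exists (Qp_class (PadicCauchySeq vC)).
rewrite -rmorphM -(rmorph1 Qp_class); apply/eqP; rewrite Qp_class_eq.
apply/padic_nullP => e e0; exists N => n Nn.
by rewrite padic_seqD padic_seqN padic_seqM/= mulVf ?un0// subrr rat_padic_abs0.
Qed.

Definition Qp_inv x : Qp p := xget 0 [set y | y * x = 1].

Lemma Qp_mulVf x : x != 0 -> Qp_inv x * x = 1.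
Proof.
by move=> /Qp_has_inverse [y yx]; rewrite /Qp_inv; case: xgetP => [//|/(_ y)].
Qed.

Lemma Qp_inv0 : Qp_inv 0 = 0.
Proof.
rewrite /Qp_inv; case: xgetP => [y _ /=|//].
by rewrite mulr0 => /esym/eqP; rewrite oner_eq0.
Qed.

HB.instance Definition _ := GRing.ComNzRing_isField.Build (Qp p) Qp_mulVf Qp_inv0.

(* The extension of |.|_p to the completion, |[u]|_p = lim |u_n|_p. Since the
   values of |.|_p on rat lie in the union of {0} and p ^ Z, so does this limit:
   it is a rational number, and Qp is accordingly a metric space over rat. *)
Definition padic_abs x : rat := 
  limn (fun n => absp (Qp_repr x n) : rat^o).

Let padic_abs_cvg x c :
  (absp (Qp_repr x n) : rat^o) @[n --> \oo] --> (c : rat^o) -> padic_abs x = c.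
Proof. by move=> xc; apply: cvg_lim xc; exact: (@Rhausdorff rat). Qed.

Lemma padic_abs0 : padic_abs 0 = 0.
Proof.
apply: padic_abs_cvg; apply/cvgrPdist_lt => e e0.
have /padic_nullP/(_ e e0)[N H] : Qp_repr 0 \in padic_null p.
  by rewrite -Qp_class_eq0 Qp_reprK.
exists N => // n /= Nn.
by rewrite sub0r normrN ger0_norm ?rat_padic_abs_ge0// H.
Qed.

Lemma padic_abs_class u : Qp_class u != 0 -> exists N, forall n, (N <= n)%N ->
  absp (u n) = padic_abs (Qp_class u).
Proof.
rewrite Qp_class_eq0 => unull.
have [c c0 [N uc]] := padic_abs_stationary unull.
set v := Qp_repr (Qp_class u).
have : v - u \in padic_null p by rewrite -Qp_class_eq Qp_reprK.
move=> /padic_nullP/(_ c c0)[K vuK].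
have vc n : (maxn N K <= n)%N -> absp (v n) = c.
  rewrite geq_max => /andP[Nn Kn].
  by rewrite -(subrK (u n) (v n)) rat_padic_abs_eqD uc//; exact: vuK.
exists N => n /uc ->; apply/esym; apply: padic_abs_cvg; apply: cvg_near_cst.
by exists (maxn N K) => // m /= /vc.
Qed.

Lemma padic_abs_repr x : x != 0 -> exists N, forall n, (N <= n)%N ->
  absp (Qp_repr x n) = padic_abs x.
Proof. by move=> x0; have := @padic_abs_class (Qp_repr x); rewrite Qp_reprK; apply. Qed.

Lemma padic_abs_gt0 x : (0 < padic_abs x) = (x != 0).
Proof.
have [->|x0] := eqVneq x 0; first by rewrite padic_abs0 ltxx.
have : Qp_repr x \notin padic_null p by rewrite -Qp_class_eq0 Qp_reprK.
move=> /padic_abs_stationary[c c0 [N xc]].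
have [K xK] := padic_abs_repr x0.
by rewrite -(xK (maxn N K)) ?leq_maxr// xc ?leq_maxl.
Qed.

Lemma padic_abs_ge0 x : 0 <= padic_abs x.
Proof.
have [->|x0] := eqVneq x 0; first by rewrite padic_abs0.
by rewrite ltW// padic_abs_gt0.
Qed.

Lemma padic_abs_eq0 x : (padic_abs x == 0) = (x == 0).
Proof. by rewrite -[RHS]negbK -padic_abs_gt0 lt0r padic_abs_ge0 andbT negbK. Qed.

Lemma padic_absM x y : padic_abs (x * y) = padic_abs x * padic_abs y.
Proof.
have [->|x0] := eqVneq x 0; first by rewrite !(mul0r, padic_abs0).
have [->|y0] := eqVneq y 0; first by rewrite !(mulr0, padic_abs0).
have [N xN] := padic_abs_repr x0; have [K yK] := padic_abs_repr y0.
have xyE : x * y = Qp_class (Qp_repr x * Qp_repr y) by rewrite (rmorphM Qp_class) /= !Qp_reprK.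
have /padic_abs_class[L xyL] : Qp_class (Qp_repr x * Qp_repr y) != 0.
  by rewrite -xyE mulf_neq0.
pose n := maxn N (maxn K L).
rewrite xyE -(xyL n) ?padic_seqM ?rat_padic_absM ?(xN n) ?(yK n)//;
  by rewrite /n !leq_max leqnn ?orbT.
Qed.

Lemma padic_absN x : padic_abs (- x) = padic_abs x.
Proof.
have [->|x0] := eqVneq x 0; first by rewrite oppr0.
have [N xN] := padic_abs_repr x0.
have xE : - x = Qp_class (- Qp_repr x) by rewrite (rmorphN Qp_class) /= Qp_reprK.
have /padic_abs_class[L xL] : Qp_class (- Qp_repr x) != 0 by rewrite -xE oppr_eq0.
by rewrite xE -(xL (maxn N L)) ?leq_maxr// padic_seqN rat_padic_absN xN ?leq_maxl.
Qed.

Lemma padic_absD x y : padic_abs (x + y) <= Num.max (padic_abs x) (padic_abs y).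
Proof.
have [->|x0] := eqVneq x 0; first by rewrite add0r le_max lexx orbT.
have [->|y0] := eqVneq y 0; first by rewrite addr0 le_max lexx.
have [->|xy0] := eqVneq (x + y) 0; first by rewrite padic_abs0 le_max padic_abs_ge0.
have [N xN] := padic_abs_repr x0; have [K yK] := padic_abs_repr y0.
have xyE : x + y = Qp_class (Qp_repr x + Qp_repr y) by rewrite (rmorphD Qp_class) /= !Qp_reprK.
have /padic_abs_class[L xyL] : Qp_class (Qp_repr x + Qp_repr y) != 0 by rewrite -xyE.
pose n := maxn N (maxn K L).
rewrite xyE -(xyL n) -?(xN n) -?(yK n) ?padic_seqD ?rat_padic_absD//;
  by rewrite /n !leq_max leqnn ?orbT.
Qed.

Definition Qp_dist x y : rat := padic_abs (x - y).

Lemma Qp_distxx x : Qp_dist x x = 0.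
Proof. by rewrite /Qp_dist subrr padic_abs0. Qed.

Lemma Qp_dist_positivity x y : Qp_dist x y = 0 -> x = y.
Proof. by move=> /eqP; rewrite padic_abs_eq0 subr_eq0 => /eqP. Qed.

Lemma Qp_dist_sym x y : Qp_dist x y = Qp_dist y x.
Proof. by rewrite /Qp_dist -padic_absN opprB. Qed.

Lemma Qp_dist_triangle y x z : Qp_dist x z <= Qp_dist x y + Qp_dist y z.
Proof.
rewrite /Qp_dist -[x - z](subrKA y) (le_trans (padic_absD _ _))//.
by rewrite ge_max lerDl lerDr !padic_abs_ge0.
Qed.

HB.instance Definition _ := isMetric.Build rat (Qp p)
  Qp_distxx Qp_dist_positivity Qp_dist_sym Qp_dist_triangle.
HB.instance Definition _ := isPointed.Build (Qp p) 0.

Lemma Qp_ballE x (e : rat) : ball x e = [set y : Qp p | padic_abs (x - y) < e].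
Proof. by rewrite ballEmdist. Qed.

Definition padic_int : set (Qp p) := [set x | padic_abs x <= 1].

Lemma padic_cauchy_cst (q : rat) : (fun=> q) \in padic_cauchy p.
Proof.
by apply/padic_cauchyP => e e0; exists 0%N => m n _ _; rewrite subrr rat_padic_abs0.
Qed.

Definition Qp_of_rat (q : rat) : Qp p := Qp_class (PadicCauchySeq (padic_cauchy_cst q)).

Lemma Qp_of_rat_is_zmod_morphism : zmod_morphism Qp_of_rat.
Proof.
move=> q r; rewrite -rmorphB; congr Qp_class.
by apply: val_inj; apply/funext.
Qed.
Lemma Qp_of_rat_is_monoid_morphism : monoid_morphism Qp_of_rat.
Proof.
split=> [|q r]; rewrite -?rmorphM -?(rmorph1 Qp_class); congr Qp_class;
  by apply: val_inj; apply/funext.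
Qed.
HB.instance Definition _ := GRing.isZmodMorphism.Build rat (Qp p)
  Qp_of_rat Qp_of_rat_is_zmod_morphism.
HB.instance Definition _ := GRing.isMonoidMorphism.Build rat (Qp p)
  Qp_of_rat Qp_of_rat_is_monoid_morphism.

Lemma ratr_Qp (q : rat) : ratr q = Qp_of_rat q.
Proof. by rewrite (fmorph_eq_rat Qp_of_rat). Qed.

Lemma padic_abs_ratr (q : rat) : padic_abs (ratr q) = absp q.
Proof.
rewrite ratr_Qp; have [->|q0] := eqVneq q 0.
  by rewrite (rmorph0 Qp_of_rat) padic_abs0 rat_padic_abs0.
 have : Qp_of_rat q != 0 by rewrite (fmorph_eq0 Qp_of_rat).
by move=> /padic_abs_class[N /(_ N (leqnn N))] <-.
Qed.

Lemma cvg_Qp_class u : (ratr (u n) : Qp p) @[n --> \oo] --> Qp_class u.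
Proof.
apply/(@cvg_ballP rat) => e e0.
have /padic_cauchyP /(_ e e0)[N uN] := padic_seqP u.
exists N => // n /= Nn; rewrite Qp_ballE/= ratr_Qp -(rmorphB Qp_class) /=.
set v := (X in Qp_class X); have [v0|/padic_abs_class[K vK]] := eqVneq (Qp_class v) 0.
  by rewrite v0 padic_abs0.
by rewrite -(vK (maxn N K)) ?leq_maxr//; apply: uN => //; rewrite leq_maxl.
Qed.

Lemma dense_rat_Qp : dense (range (fun q : rat => ratr q : Qp p)).
Proof.
move=> O [x Ox] oO.
have := @cvg_Qp_class (Qp_repr x); rewrite Qp_reprK.
move=> /(_ O (open_nbhs_nbhs (conj oO Ox)))[N _ /(_ N (leqnn N)) ON].
by exists (ratr (Qp_repr x N)); split => //; exists (Qp_repr x N).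
Qed.

Lemma Qp_complete (F : set_system (Qp p)) : ProperFilter F -> cauchy F -> cvg F.
Proof.
move=> FF Fc.
have approx n : exists q : rat,
    F [set y | padic_abs (y - ratr q) < n.+1%:R^-1].
  have n0 : 0 < n.+1%:R^-1 :> rat by rewrite invr_gt0.
  have [[A B] [/= FA FB] AB] := Fc _ (entourage_ball (Qp p) (PosNum n0)).
  have [x Ax] := filter_ex FA.
  have [K _ /(_ K (leqnn K))] := (@cvg_ballP rat _ _ _ _ _ _).1
    (@cvg_Qp_class (Qp_repr x)) _ n0.
  rewrite /= Qp_reprK Qp_ballE/= => xq.
  exists (Qp_repr x K); apply: filterS FB => y By /=.
  have := AB (x, y) (conj Ax By); rewrite /= Qp_ballE/= => xy.
  rewrite -[y - _](subrKA x) (le_lt_trans (padic_absD _ _))// gt_max.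
  by rewrite -padic_absN opprB xy.
have [u uF] := choice approx.
have uC : u \in padic_cauchy p.
  apply/padic_cauchyP => e e0.
  exists (Num.truncn e^-1) => m n Nm Nn.
  have lte k : (Num.truncn e^-1 <= k)%N -> k.+1%:R^-1 < e.
    move=> Nk; rewrite invf_plt ?posrE//.
    by rewrite (lt_le_trans (truncnS_gt _))// ler_nat.
  have [y [ym yn]] := filter_ex (filterI (uF m) (uF n)).
  rewrite -padic_abs_ratr ratr_Qp (rmorphB Qp_of_rat)/= -!ratr_Qp -[_ - _](subrKA y).
  rewrite (le_lt_trans (padic_absD _ _))// gt_max -padic_absN opprB.
  by rewrite (lt_trans ym (lte _ Nm)) (lt_trans yn (lte _ Nn)).
apply/cvg_ex; exists (Qp_class (PadicCauchySeq uC)).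
apply/(@fcvg_ballP rat) => e e0.
have [N1 _ H1] := (@cvg_ballP rat _ _ _ _ _ _).1
  (@cvg_Qp_class (PadicCauchySeq uC)) _ e0.
pose n := maxn N1 (Num.truncn e^-1).
apply: filterS (uF n) => y /= yn.
have := H1 n (leq_maxl _ _); rewrite /= !Qp_ballE/= => un.
rewrite -[_ - y](subrKA (ratr (u n))) (le_lt_trans (padic_absD _ _))// gt_max un/=.
rewrite -padic_absN opprB (lt_le_trans yn)// invf_ple ?posrE//.
by rewrite ltW// (lt_le_trans (truncnS_gt _))// ler_nat ltnS leq_maxr.
Qed.

HB.instance Definition _ := Uniform_isComplete.Build (Qp p) Qp_complete.

End PadicField.

Arguments padic_int p : clear implicits.

Definition rat_binom (a : rat) (n : nat) : rat :=
  (\prod_(i < n) (a - i%:R)) / n`!%:R.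

Definition binom_psum (K : fieldType) (a : rat) (x : K) (N : nat) : K :=
  \sum_(1 <= n < N) ratr (rat_binom a n) * x ^+ n.

Record place_seq (R : realType) := PlaceSeq {
  real_comp : R;
  padic_comp : forall p : prime_nat, Qp p
}.

Definition is_adele (R : realType) (x : place_seq R) : Prop :=
  finite_set [set p : prime_nat | ~ padic_int p (padic_comp x p)].

(* limn is the sum of the series only when the partial sums converge. *)
Definition binom_place_seq (R : realType) (a : rat) (x : place_seq R) :
    place_seq R :=
  PlaceSeq (limn (binom_psum a (real_comp x)))
           (fun p => limn (binom_psum a (padic_comp x p))).

(* Main.v *)
(* The hypothesis on a forces it to be an integer, so the coefficients
   (a choose n) are integers and every term of the p-adic series at x_p lies in the open
   p-adic unit ball. By the ultrametric inequality the series converges in Q_p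
   and its sum is a p-adic integer, for every p and not just for almost all p.
   At the real place the ratio test applies, since the quotients
   ((a - n) / (n + 1)) x of consecutive terms tend to -x. *)
Require Import Defs.
From mathcomp Require Import all_boot all_order all_algebra.
From mathcomp Require Import all_classical all_reals all_analysis.
From mathcomp Require Import ring lra.

Import Order.TTheory GRing.Theory Num.Theory.
Import numFieldNormedType.Exports.

Local Open Scope classical_set_scope.
Local Open Scope ring_scope.

Lemma rat_binomS (a : rat) (n : nat) :
  rat_binom a n.+1 = rat_binom a n * ((a - n%:R) / n.+1%:R).
Proof.
by rewrite /rat_binom big_ord_recr /= factS natrM invfM; ring.
Qed.

(** Both sides are multiples of [rat_binom a n], so Pascal's rule reduces to (a - n)/(n + 1) + 1 =
    (a + 1)/(n + 1). *)
Lemma rat_binom_pascal (a : rat) (n : nat) :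
  rat_binom (a + 1) n.+1 = rat_binom a n.+1 + rat_binom a n.
Proof.
have S0 : n.+1%:R != 0 :> rat by rewrite pnatr_eq0.
suff -> : rat_binom (a + 1) n.+1 = rat_binom a n * ((a + 1) / n.+1%:R).
  by rewrite rat_binomS -natr1; field; rewrite natr1.
rewrite /rat_binom big_ord_recl /= factS natrM invfM subr0.
(* After the leading factor a + 1, factor i + 1 is (a + 1) - (i + 1) = a - i. *)
under eq_bigr => i _ do
  rewrite /bump leq0n add1n -natr1 opprD addrACA subrr addr0.
ring.
Qed.

(** Induction on n, then on m in both directions from 0: by Pascal's rule, neighbouring values of m
    differ by a coefficient of lower index n. *)
Lemma rat_binom_int (m : int) (n : nat) : rat_binom m%:~R n \is a Num.int.
Proof.
elim: n m => [|n IHn] m; first by rewrite /rat_binom big_ord0 fact0 divr1.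
elim/int_ind: m => [|m IHm|m IHm].
- by rewrite /rat_binom big_ord_recl subrr mul0r mul0r.
- by rewrite -addn1 PoszD intrD rat_binom_pascal rpredD.
(* Downward step: Pascal's rule at -(m + 1), solved for its first summand. *)
- have := rat_binom_pascal (- (m.+1%:Z))%:~R n.
  have -> : (- (m.+1%:Z))%:~R + 1 = (- (m%:Z))%:~R :> rat.
    by rewrite -addn1 PoszD !mulrNz intrD; ring.
  by move=> /esym/(canRL (addrK _)) ->; rewrite rpredB.
Qed.

Lemma rat_padic_abs_int (p : prime_nat) (q : rat) :
  q \is a Num.int -> rat_padic_abs p q <= 1.
Proof.
move=> /intrP[m ->]; rewrite /rat_padic_abs; case: ifP => // _.
rewrite numq_int denq_int logn1 sub0r -invr_expz invf_le1 ?exprn_gt0//;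
  last by rewrite ltr0n prime_gt0 ?prime_valP.
by rewrite exprn_ege1// ler1n prime_gt0 ?prime_valP.
Qed.

(** A prime p dividing the denominator cannot divide the numerator, so it would give |a|_p > 1. *)
Lemma rat_int_local (a : rat) :
  (forall p : prime_nat, rat_padic_abs p a <= 1) -> a \is a Num.int.
Proof.
move=> ha; rewrite Qint_def; apply/eqP.
have [|d1] := leqP `|denq a|%N 1.
  by have := denq_gt0 a; case: (denq a) => // [[|[|?]]].
pose p := PrimeNat (pdiv_prime d1).
have pd : (p %| `|denq a|)%N by exact: pdiv_dvd.
have logd : (0 < logn p `|denq a|)%N.
  by rewrite logn_gt0 mem_primes prime_valP absz_gt0 denq_neq0.
have logq : logn p `|numq a| = 0%N.
  apply: logn_coprime; rewrite prime_coprime ?prime_valP//; apply/negP => pn.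
  have := coprime_num_den a; rewrite /coprime => /eqP g1.
  have := dvdn_gcd p `|numq a| `|denq a|; rewrite g1 pn pd dvdn1.
  by move=> /eqP p1; have := prime_valP p; rewrite p1.
have := ha p; rewrite /rat_padic_abs; case: eqP => [a0|_].
  by move: (d1); rewrite a0.
rewrite logq subr0 leNgt -exprnP exprn_egt1 ?ltr1n ?prime_gt1 ?prime_valP//.
by case: (logn _ _) logd.
Qed.

Section Padic.
Variable p : prime_nat.
Implicit Types x : Qp p.

Lemma padic_absX x n : padic_abs (x ^+ n) = padic_abs x ^+ n.
Proof.
elim: n => [|n IHn]; last by rewrite !exprS padic_absM IHn.
(* The value at 1 is read off through the embedding of [rat]. *)
by have := padic_abs_ratr p 1; rewrite ratr_Qp (rmorph1 (@Qp_of_rat p)) rat_padic_abs1.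
Qed.

Lemma padic_abs_sum (f : nat -> Qp p) (c : rat) (m n : nat) : 0 <= c ->
  (forall i, (m <= i)%N -> padic_abs (f i) <= c) ->
  padic_abs (\sum_(m <= i < n) f i) <= c.
Proof.
move=> c0 fc; rewrite big_nat.
apply: (big_ind (fun y => padic_abs y <= c)) => [|y z yc zc|i /andP[/fc]//].
  by rewrite padic_abs0.
by rewrite (le_trans (padic_absD _ _))// ge_max yc zc.
Qed.

(** The difference of two partial sums is no larger than a bound on its individual terms, so terms
    tending to 0 make the partial sums Cauchy, and [Qp p] is complete. *)
Lemma padic_cvg_series (f : nat -> Qp p) (m : nat) :
  (padic_abs (f n) : rat^o) @[n --> \oo] --> (0 : rat^o) ->
  cvgn (fun n => \sum_(m <= i < n) f i).
Proof.
move=> f0; apply: cauchy_cvg; apply/cauchy_exP => e e0.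
(* [padic_abs_sum] gives only a non-strict bound; e / 2 leaves room for the strict one. *)
have /cvgrPdist_lt/(_ (e / 2) (divr_gt0 e0 (ltr0Sn _ 1)))[N _ fN] := f0.
exists (\sum_(m <= i < maxn m N) f i); exists (maxn m N) => // n /= mn.
rewrite Qp_ballE/= -padic_absN opprB.
rewrite (big_cat_nat (leq_maxl m N) mn)/= addrAC subrr add0r.
apply: (@le_lt_trans _ _ (e / 2)); last by lra.
apply: padic_abs_sum => [|i]; first by lra.
rewrite geq_max => /andP[_ /fN] /=.
by rewrite sub0r normrN ger0_norm ?padic_abs_ge0// => /ltW.
Qed.

(** One term within distance 1 of the limit suffices, by the ultrametric inequality. *)
Lemma padic_int_lim (u : nat -> Qp p) : cvgn u ->
  (forall n, padic_int p (u n)) -> padic_int p (limn u).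
Proof.
move=> /(@cvg_ballP rat) /(_ 1 ltr01) [N _ /(_ N (leqnn N))].
rewrite /= Qp_ballE/= => luN uint; rewrite /padic_int/= -(subrK (u N) (limn u)).
by rewrite (le_trans (padic_absD _ _))// ge_max uint ltW.
Qed.

End Padic.

(** Absolute convergence: from index N on, the terms are dominated by a geometric sequence of ratio
    r. *)
Lemma cvg_series_ratio (R : realType) (u : R ^nat) (r : R) (N : nat) :
  0 <= r -> r < 1 -> (forall n, (N <= n)%N -> `|u n.+1| <= r * `|u n|) ->
  cvgn (series u).
Proof.
move=> r0 r1 ur; apply: normed_cvg.
rewrite -(is_cvg_series_restrict N).
have bound n : `|u (n + N)%N| <= geometric `|u N| r n.
  elim: n => [|n IHn] /=; first by rewrite expr0 mulr1.
  rewrite addSn (le_trans (ur _ (leq_addl _ _)))//.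
  by rewrite exprS mulrCA ler_wpM2l.
have : cvgn (series (fun n => `|u (n + N)%N|)).
  apply: series_le_cvg bound _ => [n|n|]; first exact: normr_ge0.
    by rewrite /= mulr_ge0// exprn_ge0.
  by apply: is_cvg_geometric_series; rewrite ger0_norm.
(* Reindexing: the shifted series at n - N is the original sum over N <= i < n. *)
move=> /cvg_ex[l]; rewrite -(cvg_centern N) => ul.
apply/cvg_ex; exists l; apply: cvg_trans ul; apply: near_eq_cvg.
by near=> n; rewrite /series/= -[N in RHS]add0n big_addn.
Unshelve. all: by end_near. Qed.

Lemma cvg_real_binom_psum (R : realType) (a : rat) (x : R) :
  `|x| < 1 -> cvgn (binom_psum a x).
Proof.
move=> x1; set A : R := `|ratr a|.
(* Restoring the term of index 0 does not affect convergence. *)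
rewrite (is_cvg_series_restrict 1 (fun n => ratr (rat_binom a n) * x ^+ n)).
(* The term ratios tend to |x| in absolute value; the midpoint of |x| and 1 serves as ratio
   bound. *)
pose r := (1 + `|x|) / 2.
have x0 := normr_ge0 x; have A0 : 0 <= A := normr_ge0 _.
(* For n >= N this gives 2A <= n(1 - |x|), whence (A + n)|x| <= A + n|x| <= r(n + 1). *)
pose N := Num.Def.archi_bound (A * 2 / (1 - `|x|)).
have lN : A * 2 / (1 - `|x|) < N%:R.
  by apply: archi_boundP; rewrite divr_ge0 ?mulr_ge0// subr_ge0 ltW.
apply: (@cvg_series_ratio _ _ r N); rewrite /r; [lra|lra|move=> n Nn].
rewrite rat_binomS exprS rmorphM/=; set b := ratr (rat_binom a n).
rewrite fmorph_div/= ratr_nat rmorphB/= ratr_nat.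
have -> : b * ((ratr a - n%:R) / n.+1%:R) * (x * x ^+ n) =
    ((ratr a - n%:R) / n.+1%:R * x) * (b * x ^+ n) by ring.
rewrite normrM ler_wpM2r// normrM normf_div (@ger0_norm _ n.+1%:R)//.
rewrite mulrAC ler_pdivrMr ?ltr0n//.
have dn : `|ratr a - n%:R| <= A + n%:R.
  by rewrite (le_trans (ler_normB _ _))// (ger0_norm (ler0n _ n)).
have {}lN : A * 2 / (1 - `|x|) <= n%:R.
  by apply: ltW; apply: lt_le_trans lN _; rewrite ler_nat.
rewrite ler_pdivrMr ?subr_gt0// in lN.
apply: (@le_trans _ _ ((A + n%:R) * `|x|)); first by rewrite ler_wpM2r.
have At : A * `|x| <= A by rewrite ler_piMr// ltW.
by rewrite -(natr1 n); lra.
Qed.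

Theorem theorem4p11 (R : realType) (a : rat)
    (ha : forall p : prime_nat, padic_int p (ratr a))
    (x : place_seq R) (hx : is_adele x)
    (hx_real : `|real_comp x| < 1)
    (hx_padic : forall p : prime_nat, padic_abs (padic_comp x p) < 1) :
  [/\ cvgn (binom_psum a (real_comp x)),
      forall p : prime_nat, cvgn (binom_psum a (padic_comp x p)) &
      is_adele (binom_place_seq a x)].
Proof.
have /rat_int_local/intrP[m am] (p : prime_nat) : rat_padic_abs p a <= 1.
  by rewrite -padic_abs_ratr; exact: ha.
have term_le p n : padic_abs (ratr (rat_binom a n) * padic_comp x p ^+ n) <=
    padic_abs (padic_comp x p) ^+ n.
  rewrite padic_absM padic_absX padic_abs_ratr ler_piMl
    ?exprn_ge0 ?padic_abs_ge0//.
  by rewrite am rat_padic_abs_int ?rat_binom_int.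
have cvg_padic p : cvgn (binom_psum a (padic_comp x p)).
  (* The terms are squeezed between 0 and the powers of |x_p|_p < 1. *)
  apply: padic_cvg_series; apply: (@squeeze_cvgr _ _ _ _ (fun=> 0)).
  - by near=> n; apply/andP; split; [exact: padic_abs_ge0 | exact: term_le].
  - exact: cvg_cst.
  - by apply: cvg_expr; rewrite ger0_norm ?padic_abs_ge0.
split=> //; first exact: cvg_real_binom_psum.
(* The exceptional set is empty: all partial sums, hence their limit, are p-adic integers. *)
apply: (@sub_finite_set _ _ set0); last exact: finite_set0.
move=> p; apply; apply: (@padic_int_lim _ _ (cvg_padic p)) => n.
apply: padic_abs_sum => // i _; apply: le_trans (term_le p i) _.
by rewrite exprn_ile1 ?padic_abs_ge0// ltW.
Unshelve. all: by end_near. Qed.
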